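(* Let $\alpha$ be an algebraic number all of whose conjugates have modulus $1$, and suppose there is a finite set $S\subset\mathbb{C}$ with $\mathbb{Z}[\alpha]=S[\alpha]$ and that the minimal cardinality of such a set equals $|M_\alpha(0)|$. Then every finite set $S\subset\mathbb{C}$ with $\mathbb{Z}[\alpha]=S[\alpha]$ and $\operatorname{Card}(S)=|M_\alpha(0)|$ satisfies $S\not\subseteq\mathbb{Z}$.
   Context: For $S\subset\mathbb{C}$ and $\alpha\in\mathbb{C}$, $S[\alpha]:=\{\sum_{j=0}^n f_j\alpha^j : n\in\mathbb{N},\ (f_0,\ldots,f_n)\in S^{n+1}\}$. For an algebraic number $\alpha$, $M_\alpha\in\mathbb{Z}[x]$ is its primitive minimal polynomial over $\mathbb{Q}$ (integer coefficients with gcd $1$); conjugates are over $\mathbb{Q}$ and include $\alpha$. *)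

(* Defs.v *)
From HB Require Import structures.
From mathcomp Require Export all_boot all_order all_algebra.
From mathcomp Require Export finmap complex.
From mathcomp Require Export mathcomp_extra boolp classical_sets reals.

Set Implicit Arguments.
Unset Strict Implicit.
Unset Printing Implicit Defensive.

Import Order.TTheory GRing.Theory Num.Theory.

Local Open Scope classical_set_scope.
Local Open Scope ring_scope.

Section Definitions.
Variable R : realType.
Local Notation C := R[i].

(* S[alpha]; every expansion has at least one digit (n = 0 is allowed), so
   0 belongs to S[alpha] only if it has an expansion with digits in S. *)
Definition expansions (S : set C) (alpha : C) : set C :=
  [set z | exists n : nat, exists f : 'I_n.+1 -> C,
     (forall j, S (f j)) /\ z = \sum_(j < n.+1) f j * alpha ^+ j].

Definition Zset : set C := range (fun m : int => m%:~R).

(* zcontents M is the gcd of the coefficients of M up to sign, so the sign of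
   the primitive minimal polynomial is left free. *)
Definition primitive_minpoly (M : {poly int}) (alpha : C) : Prop :=
  [/\ `|zcontents M|%N = 1%N,
      root (map_poly intr M) alpha &
      forall q : {poly rat}, q != 0 -> root (map_poly ratr q) alpha ->
        (size M <= size q)%N].

Definition conjugate (alpha beta : C) : Prop :=
  exists2 M : {poly int},
    primitive_minpoly M alpha & root (map_poly intr M) beta.

Definition digit_set (alpha : C) (S : {fset C}) : Prop :=
  expansions Zset alpha = expansions [set` S] alpha.

Definition min_digit_card (alpha : C) (m : nat) : Prop :=
  (exists2 S : {fset C}, digit_set alpha S & #|` S|%fset = m) /\
  (forall S : {fset C}, digit_set alpha S -> (m <= #|` S|%fset)%N).

End Definitions.

Arguments Zset {R}.

(* Main.v *)
(** Let A = Z[alpha] and suppose that S consists of integers. As A / alpha A is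
    Z / M(0) and the |M(0)| elements of S meet every class, S is a complete
    system of residues modulo alpha: each z in A is s + alpha * T z for exactly
    one s in S, with T z in A, and z has an expansion only if an iterate of T
    maps z to 0. Since alpha is unimodular and s is real,
    (T z)^* = alpha * (z^* - s). Hence T maps L = {z in A | z^* in alpha A} into
    itself, and it is injective there, because T z determines z^* - s, hence
    the class of s modulo alpha. All of L being absorbed by the T-cycle of 0,
    injectivity forces L to be contained in that finite cycle, although L
    contains every multiple of M(0) / alpha. *)

From HB Require Import structures.
Require Import Defs.

Set Implicit Arguments.
Unset Strict Implicit.
Unset Printing Implicit Defensive.

Local Open Scope classical_set_scope.
Local Open Scope ring_scope.

Import Order.TTheory GRing.Theory Num.Theory.

Lemma absorbed_in_traject (X : eqType) (T : X -> X) (L : {pred X})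
    (x0 : X) (p n : nat) :
  {homo T : x / x \in L} -> {in L &, injective T} ->
  x0 \in L -> iter p.+1 T x0 = x0 ->
  {in L, forall x, iter n T x = x0 -> x \in traject T x0 p.+1}.
Proof.
move=> homoT injT Lx0 Tx0.
have cycle k : iter k T x0 \in traject T x0 p.+1.
  by apply/loopingP; rewrite /looping Tx0 mem_head.
elim: n => [|n IHn] x Lx; first by move=> /= ->; exact: (cycle 0).
rewrite iterSr => /(IHn _ (homoT _ Lx))/trajectP[i _ Tx].
suff -> : x = iter (i + p) T x0 by [].
apply: injT => //; first exact: iter_in.
by rewrite -iterS -addnS iterD Tx0.
Qed.

Lemma natmul_notin_seq (R : numDomainType) (x : R) (s : seq R) :
  x != 0 -> exists k, x *+ k \notin s.
Proof.
move=> x_neq0; apply: contrapT => /forallNP all_in_s.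
pose multiples := [seq x *+ k | k <- iota 0 (size s).+1].
have multiples_uniq : uniq multiples.
  by rewrite map_inj_uniq ?iota_uniq//; exact: mulrIn.
suff : (size multiples <= size s)%N by rewrite size_map size_iota ltnn.
apply: uniq_leq_size => // _ /mapP[k _ ->].
exact/negPn/negP/all_in_s.
Qed.

Lemma representatives_inequivalent (X : choiceType) (e : rel X) (I : finType)
    (c : I -> X) (S : {fset X}) :
  symmetric e -> transitive e ->
  (forall i j, e (c i) (c j) -> i = j) ->
  (forall i, exists2 s, s \in S & e (c i) s) ->
  (#|` S| <= #|I|)%N ->
  {in S &, forall s t, e s t -> s = t}.
Proof.
move=> e_sym e_trans c_ineq c_repr leSI.
have /choice[f cf] i : exists s : S, e (c i) (val s).
  by have [s Ss cs] := c_repr i; exists [` Ss]%fset.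
have f_inj : injective f.
  move=> i j fij; apply: c_ineq; apply: e_trans (cf i) _.
  by rewrite e_sym fij.
have f_onto s (Ss : s \in S) : exists i, s = val (f i).
  have : [` Ss]%fset \in codom f by apply: inj_card_onto; rewrite -?cardfE.
  by case/codomP=> i fi; exists i; rewrite -fi.
move=> s t /f_onto[i ->] /f_onto[j ->] efij; congr (val (f _)).
by apply: c_ineq; apply: e_trans (cf i) (e_trans _ _ _ efij _); rewrite e_sym.
Qed.

Lemma min_size_root_dvdp (F L : fieldType) (iota : {rmorphism F -> L})
    (m p : {poly F}) (a : L) :
  m != 0 -> root (map_poly iota m) a ->
  (forall q, q != 0 -> root (map_poly iota q) a -> (size m <= size q)%N) ->
  root (map_poly iota p) a -> m %| p.
Proof.
move=> m_neq0 m_root m_min p_root; apply/negPn/negP => /m_min.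
rewrite map_modp /root horner_mod// => /(_ p_root).
by rewrite leqNgt ltn_modp m_neq0.
Qed.

Lemma primitive_dvdp_horner (m p : {poly int}) (x : int) :
  `|zcontents m|%N = 1%N -> m %| p -> (m.[x] %| p.[x])%Z.
Proof.
move=> m_prim /dvdpP_int[q ->].
rewrite [X in (X.[_] %| _)%Z](zpolyEprim m) hornerM hornerZ.
by apply: dvdz_mulr; rewrite dvdzE abszM m_prim mul1n.
Qed.

Section IntegerAdjunction.
Variables (K : comNzRingType) (a : K).

Definition int_adjoin : {pred K} :=
  [pred z | `[< exists p : {poly int}, z = (map_poly intr p).[a] >]].

Lemma int_adjoinP z :
  reflect (exists p : {poly int}, z = (map_poly intr p).[a]) (z \in int_adjoin).
Proof. exact: asboolP. Qed.

Fact int_adjoin_subring_closed : subring_closed int_adjoin.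
Proof.
split=> [|_ _ /int_adjoinP[p ->] /int_adjoinP[q ->]|
          _ _ /int_adjoinP[p ->] /int_adjoinP[q ->]]; apply/int_adjoinP.
- by exists 1; rewrite rmorph1 hornerC.
- by exists (p - q); rewrite rmorphB hornerD hornerN.
- by exists (p * q); rewrite rmorphM hornerM.
Qed.

HB.instance Definition _ :=
  GRing.isSubringClosed.Build K int_adjoin int_adjoin_subring_closed.

Lemma int_adjoin_gen : a \in int_adjoin.
Proof. by apply/int_adjoinP; exists 'X; rewrite map_polyX hornerX. Qed.

Lemma int_adjoin_sum n (f : 'I_n -> K) :
  (forall j, f j \in int_adjoin) -> \sum_(j < n) f j * a ^+ j \in int_adjoin.
Proof.
move=> Af; apply: rpred_sum => j _.
by rewrite rpredM ?rpredX ?int_adjoin_gen.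
Qed.

Lemma sum_exp_recl n (f : 'I_n.+1 -> K) :
  \sum_(j < n.+1) f j * a ^+ j =
    f ord0 + a * \sum_(j < n) f (lift ord0 j) * a ^+ j.
Proof.
rewrite big_ord_recl expr0 mulr1 mulr_sumr; congr (_ + _).
by apply: eq_bigr => j _; rewrite exprS mulrCA.
Qed.

End IntegerAdjunction.

Section CongruenceModGenerator.
Variables (K : fieldType) (a : K).
Hypothesis a_neq0 : a != 0.

Local Notation A := (int_adjoin a).

(* Total when a = 0, since x / 0 = 0. *)
Definition eqmod_gen : rel K := fun x y => (x - y) / a \in A.

Lemma eqmod_gen_sym : symmetric eqmod_gen.
Proof. by move=> x y; rewrite /eqmod_gen -opprB mulNr rpredN. Qed.

Lemma eqmod_gen_trans : transitive eqmod_gen.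
Proof.
by move=> y x z xy yz; rewrite /eqmod_gen -(subrKA y) mulrDl rpredD.
Qed.

Lemma eqmod_genDM x u : u \in A -> eqmod_gen (x + a * u) x.
Proof. by move=> Au; rewrite /eqmod_gen addrC addKr mulrC mulKf. Qed.

Lemma eqmod_gen_horner (p : {poly int}) :
  eqmod_gen (map_poly intr p).[a] p.[0]%:~R.
Proof.
have /factor_theorem[q pE] : root (p - p.[0]%:P) 0.
  by rewrite /root hornerD hornerN hornerC subrr.
rewrite -[p in (map_poly _ p)](subrK p.[0]%:P) pE subr0.
rewrite rmorphD rmorphM /= map_polyX map_polyC hornerD hornerM hornerX hornerC.
by rewrite addrC mulrC eqmod_genDM//; apply/int_adjoinP; exists q.
Qed.

End CongruenceModGenerator.

Section DigitShift.
Variables (K : fieldType) (a : K) (S : {fset K}).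

Local Notation A := (int_adjoin a).

Definition complete_residues : Prop :=
  [/\ {subset S <= A},
      {in A, forall z, exists2 s, s \in S & eqmod_gen a z s} &
      {in S &, forall s t, eqmod_gen a s t -> s = t}].

Definition digit (z : K) : K := nth 0 S (find (eqmod_gen a z) S).

Definition digit_shift (z : K) : K := (z - digit z) / a.

Hypothesis a_neq0 : a != 0.
Hypothesis S_residues : complete_residues.

Lemma digitP z : z \in A -> digit z \in S /\ eqmod_gen a z (digit z).
Proof.
have [_ S_complete _] := S_residues.
move=> /S_complete[s Ss zs].
have has_digit : has (eqmod_gen a z) S by apply/hasP; exists s.
split; last exact: nth_find.
by apply: mem_nth; rewrite -has_find.
Qed.

Lemma digit_shift_in z : z \in A -> digit_shift z \in A.
Proof. by case/digitP. Qed.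

Lemma digit_in z : z \in A -> digit z \in A.
Proof. by have [SA _ _] := S_residues; case/digitP => /SA. Qed.

Lemma digit_shiftK z : digit z + a * digit_shift z = z.
Proof. by rewrite mulrC divfK// addrC subrK. Qed.

Lemma digit_shiftDM s u : s \in S -> u \in A -> digit_shift (s + a * u) = u.
Proof.
have [SA _ S_incongruent] := S_residues.
move=> Ss Au; have Az : s + a * u \in A.
  by rewrite rpredD ?(SA s) ?rpredM ?int_adjoin_gen.
have [Sd zd] := digitP Az.
have digit_z : digit (s + a * u) = s.
  apply: S_incongruent => //; rewrite eqmod_gen_sym; apply: eqmod_gen_trans zd.
  by rewrite eqmod_gen_sym eqmod_genDM.
by rewrite /digit_shift digit_z addrC addKr mulrC mulKf.
Qed.

Lemma iter_digit_shift_sum n (f : 'I_n -> K) :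
  (forall j, f j \in S) -> iter n digit_shift (\sum_(j < n) f j * a ^+ j) = 0.
Proof.
have [SA _ _] := S_residues.
elim: n f => [|n IHn] f Sf; first by rewrite big_ord0.
rewrite iterSr sum_exp_recl digit_shiftDM ?IHn// int_adjoin_sum// => j.
exact: SA.
Qed.

End DigitShift.

Section RealDigits.
Variables (K : numClosedFieldType) (a : K) (S : {fset K}).
Hypothesis a_unimodular : `|a| = 1.
Hypothesis S_residues : complete_residues a S.
Hypothesis S_real : {subset S <= Num.real}.

Local Notation A := (int_adjoin a).

Definition conj_multiples : {pred K} := [pred z | (z \in A) && (z^* / a \in A)].

Lemma unimodular_neq0 : a != 0.
Proof. by rewrite -normr_eq0 a_unimodular oner_eq0. Qed.

Lemma unimodular_conj : a^* = a^-1.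
Proof. by rewrite invC_norm a_unimodular expr1n invr1 mul1r. Qed.

Lemma conj_multiple_conj z : z \in conj_multiples -> z^* \in A.
Proof.
case/andP=> _ Azc; rewrite -[z^*](divfK unimodular_neq0).
by rewrite rpredM ?int_adjoin_gen.
Qed.

Lemma conj_digit_shift z :
  z \in A -> (digit_shift a S z)^* / a = z^* - digit a S z.
Proof.
case/(digitP S_residues)=> /S_real/CrealP digit_conj _.
rewrite rmorphM rmorphB /= digit_conj fmorphV /= unimodular_conj invrK.
by rewrite mulfK ?unimodular_neq0.
Qed.

Lemma digit_shift_conj_multiples :
  {homo digit_shift a S : z / z \in conj_multiples}.
Proof.
move=> z Lz; have /andP[Az _] := Lz.
apply/andP; split; first exact: digit_shift_in.
by rewrite conj_digit_shift// rpredB ?conj_multiple_conj ?digit_in.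
Qed.

Lemma digit_shift_inj : {in conj_multiples &, injective (digit_shift a S)}.
Proof.
move=> x y /andP[Ax Acx] /andP[Ay Acy] eq_shift.
have [_ _ S_incongruent] := S_residues.
have [Sx _] := digitP S_residues Ax; have [Sy _] := digitP S_residues Ay.
have digitE z : z \in A -> digit a S z = z^* - (digit_shift a S z)^* / a.
  by move=> Az; rewrite conj_digit_shift// subKr.
have eq_digit : digit a S x = digit a S y.
  apply: S_incongruent => //; rewrite /eqmod_gen !digitE// eq_shift.
  by rewrite opprB addrA subrK mulrBl rpredB.
rewrite -(digit_shiftK S unimodular_neq0 x) eq_digit eq_shift.
exact: digit_shiftK unimodular_neq0 y.
Qed.

Lemma conj_multiples_finite :
  {in A, forall z, exists n, iter n.+1 (digit_shift a S) z = 0} ->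
  exists s : seq K, {subset conj_multiples <= s}.
Proof.
move=> absorbed; have [p cycle0] := absorbed 0 (rpred0 _).
exists (traject (digit_shift a S) 0 p.+1) => z Lz.
have /andP[/absorbed[n absorbed_z] _] := Lz.
apply: absorbed_in_traject cycle0 z Lz absorbed_z.
- exact: digit_shift_conj_multiples.
- exact: digit_shift_inj.
- by rewrite inE rmorph0 mul0r !rpred0.
Qed.

Lemma intr_div_conj_multiples (m : int) k :
  m%:~R / a \in A -> (m%:~R / a) *+ k \in conj_multiples.
Proof.
move=> Am; apply/andP; split; first exact: rpredMn.
rewrite rmorphMn rmorphM /= rmorph_int fmorphV /= unimodular_conj invrK.
by rewrite mulrnAl mulfK ?unimodular_neq0// rpredMn ?rpred_int.
Qed.

End RealDigits.

Section PrimitiveMinimalPolynomial.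
Variables (R : realType) (alpha : R[i]) (M : {poly int}).
Hypothesis M_minpoly : primitive_minpoly M alpha.

Lemma primitive_minpoly_neq0 : M != 0.
Proof.
case: M_minpoly => M_prim _ _.
by apply: contra_eq_neq M_prim => ->; rewrite zcontents0.
Qed.

Lemma primitive_minpoly_dvdp (p : {poly int}) :
  root (map_poly intr p) alpha -> M %| p.
Proof.
case: M_minpoly => _ M_root M_min p_root.
have intr_ratr (q : {poly int}) :
    map_poly ratr (map_poly intr q : {poly rat}) =
      map_poly intr q :> {poly R[i]}.
  by rewrite -map_poly_comp; apply: eq_map_poly => m /=; rewrite ratr_int.
have size_intr : size (map_poly intr M : {poly rat}) = size M.
  by rewrite size_map_inj_poly ?rmorph0//; exact: intr_inj.
rewrite -dvdp_rat_int; apply: (@min_size_root_dvdp _ _ ratr _ _ alpha).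
- by rewrite -size_poly_eq0 size_intr size_poly_eq0 primitive_minpoly_neq0.
- by rewrite intr_ratr.
- by rewrite size_intr.
- by rewrite intr_ratr.
Qed.

Hypothesis alpha_neq0 : alpha != 0.

Lemma primitive_minpoly_coef0_neq0 : M.[0] != 0.
Proof.
have M_neq0 := primitive_minpoly_neq0.
apply/negP => /factor_theorem[q].
rewrite subr0 => ME; have q_neq0 : q != 0.
  by apply: contra_neq M_neq0; rewrite ME => ->; rewrite mul0r.
have /(dvdp_leq q_neq0) : M %| q.
  apply: primitive_minpoly_dvdp; case: M_minpoly => _ + _.
  by rewrite ME rmorphM /= map_polyX rootM rootX (negPf alpha_neq0) orbF.
by rewrite ME size_mulX// ltnn.
Qed.

Lemma intr_div_gen_in (m : int) :
  (m%:~R / alpha \in int_adjoin alpha) = (M.[0] %| m)%Z.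
Proof.
case: M_minpoly => M_prim /rootP M_root _.
apply/idP/dvdzP => [/int_adjoinP[p pE]|[k ->]].
  have /primitive_minpoly_dvdp/(primitive_dvdp_horner 0 M_prim) :
      root (map_poly intr (m%:P - p * 'X)) alpha.
    rewrite /root rmorphB rmorphM /= map_polyC map_polyX.
    by rewrite hornerD hornerN hornerM hornerC hornerX -pE divfK ?subrr.
  by rewrite hornerD hornerN hornerMX hornerC mulr0 subr0 => /dvdzP.
rewrite rmorphM -mulrA rpredM ?rpred_int//.
have := eqmod_gen_horner alpha_neq0 M.
by rewrite eqmod_gen_sym M_root /eqmod_gen subr0.
Qed.

Lemma eqmod_gen_int (m n : int) :
  eqmod_gen alpha m%:~R n%:~R = (m == n %[mod M.[0]])%Z.
Proof. by rewrite /eqmod_gen -rmorphB intr_div_gen_in eqz_mod_dvd. Qed.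

End PrimitiveMinimalPolynomial.

Section DigitSets.
Variables (R : realType) (alpha : R[i]) (S : {fset R[i]}).
Hypothesis S_digits : digit_set alpha S.

Local Notation A := (int_adjoin alpha).

Lemma expansions_Zset : expansions Zset alpha = [set` A].
Proof.
apply/seteqP; split=> z /=.
  move=> [n [f [Zf ->]]]; apply: int_adjoin_sum => j.
  by have [m _ <-] := Zf j; exact: rpred_int.
case/int_adjoinP=> p ->.
exists (size p), (fun j : 'I_(size p).+1 => (p`_j)%:~R); split=> [j|].
  by exists p`_j.
rewrite (@horner_coef_wide _ (size p).+1) ?(leq_trans (size_poly _ _))//.
by apply: eq_bigr => j _; rewrite coef_map.
Qed.

Lemma digit_set_expansion z : z \in A ->
  exists n (f : 'I_n.+1 -> R[i]),
    (forall j, f j \in S) /\ z = \sum_(j < n.+1) f j * alpha ^+ j.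
Proof.
move=> Az; suff : expansions [set` S] alpha z by [].
by rewrite -S_digits expansions_Zset.
Qed.

Hypothesis alpha_neq0 : alpha != 0.

Lemma digit_set_exists_digit :
  {subset S <= A} -> {in A, forall z, exists2 s, s \in S & eqmod_gen alpha z s}.
Proof.
move=> SA z /digit_set_expansion[n [f [Sf ->]]]; exists (f ord0) => //.
by rewrite sum_exp_recl eqmod_genDM// int_adjoin_sum// => j; apply: SA.
Qed.

Lemma digit_shift_absorbed : complete_residues alpha S ->
  {in A, forall z, exists n, iter n.+1 (digit_shift alpha S) z = 0}.
Proof.
move=> S_residues z /digit_set_expansion[n [f [Sf ->]]]; exists n.
exact: iter_digit_shift_sum.
Qed.

Lemma digit_set_complete_residues (M : {poly int}) :
  primitive_minpoly M alpha -> {subset S <= A} -> #|` S|%fset = `|M.[0]|%N ->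
  complete_residues alpha S.
Proof.
move=> M_minpoly SA S_card; have S_complete := digit_set_exists_digit SA.
split=> //.
apply: (@representatives_inequivalent _ _ 'I_`|M.[0]| (fun i => (i%:Z)%:~R)).
- exact: eqmod_gen_sym.
- exact: eqmod_gen_trans.
- move=> i j; rewrite (eqmod_gen_int M_minpoly)//.
  rewrite -modz_abs -[X in _ == X]modz_abs !modz_nat.
  by rewrite eqz_nat !modn_small// => /eqP/val_inj.
- by move=> i; apply: S_complete; exact: rpred_int.
- by rewrite S_card card_ord.
Qed.

End DigitSets.

Theorem theorem2 (R : realType) (alpha : R[i]) (M : {poly int})
    (alpha_alg : algebraicOver (ratr : rat -> R[i]) alpha)
    (M_minpoly : primitive_minpoly M alpha)
    (conj_unimodular : forall beta : R[i], conjugate alpha beta -> `|beta| = 1)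
    (min_card : min_digit_card alpha `|M.[0]|%N) :
  forall S : {fset R[i]},
    digit_set alpha S -> #|` S|%fset = `|M.[0]|%N -> ~ ([set` S] `<=` Zset).
Proof.
move=> S S_digits S_card S_int.
have alpha_unimodular : `|alpha| = 1.
  by apply: conj_unimodular; exists M => //; case: M_minpoly.
have alpha_neq0 := unimodular_neq0 alpha_unimodular.
have SA : {subset S <= int_adjoin alpha}.
  by move=> s /S_int[m _ <-]; exact: rpred_int.
have S_real : {subset S <= Num.real}.
  by move=> s /S_int[m _ <-]; exact: rpred_int.
have S_residues :=
  digit_set_complete_residues S_digits alpha_neq0 M_minpoly SA S_card.
have [s conj_multiples_s] := conj_multiples_finite alpha_unimodular S_residues
  S_real (digit_shift_absorbed S_digits alpha_neq0 S_residues).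
have M0_neq0 := primitive_minpoly_coef0_neq0 M_minpoly alpha_neq0.
have [|k /negP[]] := @natmul_notin_seq _ (M.[0]%:~R / alpha) s.
  by rewrite mulf_neq0 ?invr_eq0 ?intr_eq0.
apply/conj_multiples_s/intr_div_conj_multiples => //.
by rewrite (intr_div_gen_in M_minpoly).
Qed.
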